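(* Let $A$ be a supercommutative superalgebra over a field of characteristic $0$, let $V=A^{p|q}$ be a free $A$-supermodule of rank $p|q$ with basis $\{x_1,\dots,x_p\,|\,\theta_1,\dots,\theta_q\}$, and let $R=\mathrm{Sym}_A^\bullet V$ and $R^\pi=\mathrm{Sym}_A^\bullet\Pi V$. Let $\mathcal{K}_\bullet=R\otimes_A R^\pi$ and $$\delta=\sum_{i=1}^p x_i\otimes\partial_{\chi_i}+\sum_{j=1}^q\theta_j\otimes\partial_{\ell_j}:\mathcal{K}_\bullet\to\mathcal{K}_\bullet .$$ Then the pair $(\mathcal{K}_\bullet,\delta)$ is a differentially graded (dg) $R$-algebra.
   Context: $x_i$ is even and $\theta_j$ is odd. $\Pi$ is the parity-changing functor; $\Pi V$ has basis $\{\ell_1,\dots,\ell_q\,|\,\chi_1,\dots,\chi_p\}$ with $\ell_j=\pi\theta_j$ even and $\chi_i=\pi x_i$ odd. $\mathrm{Sym}^k$ is the supersymmetric $k$-th power over $A$. $\mathcal{K}_\bullet=\bigoplus_{k\ge0}\mathcal{K}_{-k}$ with $\mathcal{K}_{-k}=R\otimes_A\mathrm{Sym}^k\Pi V$; it is a supercommutative $A$-algebra, and an $R$-algebra via its first factor. Tensor products of operators act with the Koszul sign rule $(F\otimes G)(r\otimes s)=(-1)^{|G||r|}F(r)\otimes G(s)$. Here ''differentially graded $R$-algebra'' means: $\delta$ is odd for the $\mathbb{Z}_2$-grading, maps $\mathcal{K}_{-k}$ to $\mathcal{K}_{-k+1}$ (with $\mathcal{K}_{1}=0$), is $R$-linear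 in the super sense ($\delta(r\,m)=(-1)^{|r|}r\,\delta(m)$ for homogeneous $r\in R$), satisfies the Leibniz rule $\delta(st)=\delta(s)t+(-1)^{|s|}s\,\delta(t)$ with $|s|$ the $\mathbb{Z}_2$-parity, and satisfies $\delta\circ\delta=0$. *)

(* Defs.v *)
From HB Require Import structures.
From mathcomp Require Import all_boot all_algebra.
From mathcomp Require Import boolp classical_sets.
From mathcomp Require Import generic_quotient.

Set Implicit Arguments.
Unset Strict Implicit.
Unset Printing Implicit Defensive.

Import GRing.Theory.
Local Open Scope ring_scope.
Local Open Scope quotient_scope.

(* Z/2-graded objects. A grading V = V_0 (+) V_1 is given by its two
   projections; [true] stands for odd, [false] for even. *)

HB.mixin Record isSuperZmodule V of GRing.Zmodule V := {
  hproj : bool -> V -> V;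
  hprojD : forall b x y, hproj b (x + y) = hproj b x + hproj b y;
  hprojK : forall b c x, hproj b (hproj c x) = if b == c then hproj c x else 0;
  hproj_sum : forall x, hproj false x + hproj true x = x }.
#[short(type="superZmodType")]
HB.structure Definition SuperZmodule :=
  {V of GRing.Zmodule V & isSuperZmodule V}.

Definition homog (V : superZmodType) (b : bool) (x : V) : Prop := hproj b x = x.

(* The parity involution x |-> (-1)^{|x|} x, and its power with exponent b. *)
Definition ginv (V : superZmodType) (x : V) : V := hproj false x - hproj true x.
Definition sginv (V : superZmodType) (b : bool) (x : V) : V :=
  if b then ginv x else x.

HB.mixin Record isSuperRing R of GRing.PzRing R & SuperZmodule R := {
  homog1 : homog false (1 : R);
  homogM : forall b c (x y : R),
    homog b x -> homog c y -> homog (b (+) c) (x * y) }.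
#[short(type="superRingType")]
HB.structure Definition SuperRing :=
  {R of GRing.PzRing R & SuperZmodule R & isSuperRing R}.

HB.mixin Record isSupercommutative R of SuperRing R := {
  supermulC : forall b c (x y : R), homog b x -> homog c y ->
    x * y = (-1) ^+ (b && c) * (y * x) }.
#[short(type="superComRingType")]
HB.structure Definition SuperComRing :=
  {R of SuperRing R & isSupercommutative R}.

(* Superalgebras over a purely even commutative ring k, given by the structure
   morphism k -> A; the zero algebra is allowed, unlike in the library's algType. *)
HB.mixin Record isSuperAlgebra (k : comPzRingType) A of SuperRing A := {
  ink : k -> A;
  inkD : forall a b, ink (a + b) = ink a + ink b;
  inkM : forall a b, ink (a * b) = ink a * ink b;
  ink1 : ink 1 = 1;
  homog_ink : forall a, homog false (ink a);
  ink_central : forall a x, ink a * x = x * ink a }.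
#[short(type="superAlgType")]
HB.structure Definition SuperAlgebra (k : comPzRingType) :=
  {A of SuperRing A & isSuperAlgebra k A}.
#[short(type="superComAlgType")]
HB.structure Definition SuperComAlgebra (k : comPzRingType) :=
  {A of SuperComRing A & isSuperAlgebra k A}.

HB.mixin Record isSuperModule (A : superRingType) M
    of GRing.Lmodule A M & SuperZmodule M := {
  homogZ : forall b c (a : A) (m : M),
    homog b a -> homog c m -> homog (b (+) c) (a *: m) }.
#[short(type="superModType")]
HB.structure Definition SuperModule (A : superRingType) :=
  {M of GRing.Lmodule A M & SuperZmodule M & isSuperModule A M}.

(* Superalgebras over a supercommutative ring A: superrings with an even ring
   morphism from A whose image is supercentral. *)
HB.mixin Record isSuperAlgOver (A : superComRingType) S of SuperRing S := {
  inA : A -> S;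
  inAD : forall a b, inA (a + b) = inA a + inA b;
  inAM : forall a b, inA (a * b) = inA a * inA b;
  inA1 : inA 1 = 1;
  homog_inA : forall b a, homog b a -> homog b (inA a);
  inA_central : forall b c (a : A) (s : S), homog b a -> homog c s ->
    s * inA a = (-1) ^+ (b && c) * (inA a * s) }.
#[short(type="superAlgOverType")]
HB.structure Definition SuperAlgOver (A : superComRingType) :=
  {S of SuperRing S & isSuperAlgOver A S}.

Arguments inA {A s} a.
Arguments homogM {s b c x y}.
Arguments supermulC {s b c x y}.
Arguments homogZ {A s b c a m}.
Arguments homog_inA {A s b a}.
Arguments inA_central {A s b c a _}.

Section SuperTheory.
Implicit Types V : superZmodType.

Lemma hproj0 V b : hproj b (0 : V) = 0.
Proof. by apply: (addrI (hproj b 0)); rewrite -hprojD !addr0. Qed.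

Lemma hprojN V b (x : V) : hproj b (- x) = - hproj b x.
Proof. by apply/eqP; rewrite -addr_eq0 -hprojD addNr hproj0. Qed.

Lemma hproj_homog V b (x : V) : homog b (hproj b x).
Proof. by rewrite /homog hprojK eqxx. Qed.

Lemma homog_proj V b c (x : V) : homog b x -> hproj c x = if c == b then x else 0.
Proof. by move=> <-; rewrite hprojK; case: eqP. Qed.

Lemma homog0 V b : homog b (0 : V). Proof. exact: hproj0. Qed.

Lemma homogD V b (x y : V) : homog b x -> homog b y -> homog b (x + y).
Proof. by rewrite /homog hprojD => -> ->. Qed.

Lemma homogN V b (x : V) : homog b x -> homog b (- x).
Proof. by rewrite /homog hprojN => ->. Qed.

Lemma homog_sign (R : superRingType) b c (x : R) :
  homog b x -> homog b ((-1) ^+ c * x).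
Proof.
by move=> hx; rewrite -signr_odd; case: odd; rewrite ?expr1 ?expr0 ?mulN1r ?mul1r //;
  exact: homogN.
Qed.

Lemma ginvD V (x y : V) : ginv (x + y) = ginv x + ginv y.
Proof. by rewrite /ginv !hprojD opprD addrACA. Qed.

Lemma sginvD V b (x y : V) : sginv b (x + y) = sginv b x + sginv b y.
Proof. by case: b => //=; exact: ginvD. Qed.

Lemma sginv0 V b : sginv b (0 : V) = 0.
Proof. by case: b => //=; rewrite /ginv !hproj0 subrr. Qed.

Lemma sginvN V b (x : V) : sginv b (- x) = - sginv b x.
Proof. by case: b => //=; rewrite /ginv !hprojN opprD. Qed.

Lemma sginv_homog V b c (x : V) :
  homog c x -> sginv b x = if b && c then - x else x.
Proof.
case: b => //= hx; rewrite /ginv !(homog_proj _ hx).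
by case: c hx => _ /=; rewrite ?sub0r ?subr0.
Qed.

Lemma homog_sginv V b c (x : V) : homog c x -> homog c (sginv b x).
Proof. by move=> hx; rewrite (sginv_homog _ hx); case: ifP => // _; exact: homogN. Qed.

Lemma hproj_sginv V b c (x : V) : hproj c (sginv b x) = sginv b (hproj c x).
Proof.
rewrite (sginv_homog b (hproj_homog c x)).
case: b => //=; rewrite /ginv hprojD hprojN !hprojK.
by case: c => /=; rewrite ?sub0r ?subr0.
Qed.

Lemma homog_ind V (P : V -> Prop) :
  (forall x y, P x -> P y -> P (x + y)) ->
  (forall b x, homog b x -> P x) -> forall x, P x.
Proof.
by move=> PD Ph x; rewrite -(hproj_sum x); apply: PD; apply: Ph; apply: hproj_homog.
Qed.

Lemma sginv_add V b c (x : V) : sginv b (sginv c x) = sginv (b (+) c) x.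
Proof.
elim/homog_ind: x => [x y ihx ihy|d x hx]; first by rewrite !sginvD ihx ihy.
rewrite (sginv_homog b (homog_sginv c hx)) !(sginv_homog _ hx).
by case: b c d {hx} => [] [] []; rewrite /= ?opprK.
Qed.

Lemma sginvM (R : superRingType) b (x y : R) :
  sginv b (x * y) = sginv b x * sginv b y.
Proof.
elim/homog_ind: x => [x1 x2 h1 h2|c x hx]; first by rewrite mulrDl !sginvD h1 h2 mulrDl.
elim/homog_ind: y => [x1 x2 h1 h2|d y hy]; first by rewrite mulrDr !sginvD h1 h2 mulrDr.
rewrite (sginv_homog b (homogM hx hy)) (sginv_homog b hx) (sginv_homog b hy).
by case: b c d {hx hy} => [] [] []; rewrite /= ?mulrNN ?mulNr ?mulrN.
Qed.

Lemma sginvZ (A : superRingType) (M : superModType A) b (a : A) (m : M) :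
  sginv b (a *: m) = sginv b a *: sginv b m.
Proof.
elim/homog_ind: a => [x1 x2 h1 h2|c a ha]; first by rewrite scalerDl !sginvD h1 h2 scalerDl.
elim/homog_ind: m => [x1 x2 h1 h2|d m hm]; first by rewrite scalerDr !sginvD h1 h2 scalerDr.
rewrite (sginv_homog b (homogZ ha hm)) (sginv_homog b ha) (sginv_homog b hm).
by case: b c d {ha hm} => [] [] []; rewrite /= ?scalerN ?scaleNr ?opprK.
Qed.

Lemma sginv1 (R : superRingType) b : sginv b (1 : R) = 1.
Proof. by rewrite (sginv_homog b (@homog1 R)) andbF. Qed.

Variables (A : superComRingType) (S : superAlgOverType A).

Lemma inA0 : inA 0 = 0 :> S.
Proof. by apply: (addrI (inA 0)); rewrite -inAD !addr0. Qed.

Lemma inAN (a : A) : inA (- a) = - inA a :> S.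
Proof. by apply/eqP; rewrite -addr_eq0 -inAD addNr inA0. Qed.

Lemma inA_sginv b (a : A) : inA (sginv b a) = sginv b (inA a) :> S.
Proof.
elim/homog_ind: a => [x1 x2 h1 h2|c a ha]; first by rewrite inAD !sginvD inAD h1 h2.
rewrite (sginv_homog _ ha) (sginv_homog _ (homog_inA ha)).
by case: ifP; rewrite ?inAN.
Qed.

End SuperTheory.

(* Symmetric algebra of a supermodule M: the A-superalgebra presented by the
   elements of A and M, i.e. the tensor algebra of M over A, where
   m a = (-1)^{|a||m|} a m, modulo m n = (-1)^{|m||n|} n m. *)

Inductive symterm (A M : Type) : Type :=
| SScal of A
| SGen of M
| SAdd of symterm A M & symterm A M
| SOpp of symterm A M
| SMul of symterm A M & symterm A M.
Arguments SScal {A M} _.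
Arguments SGen {A M} _.

Definition ssign {A M} (b : bool) (t : symterm A M) : symterm A M :=
  if b then SOpp t else t.

Inductive symcong (A : superComRingType) (M : superModType A) :
    symterm A M -> symterm A M -> Prop :=
| sc_refl t : symcong t t
| sc_sym t u : symcong t u -> symcong u t
| sc_trans t u v : symcong t u -> symcong u v -> symcong t v
| sc_add t t' u u' :
    symcong t t' -> symcong u u' -> symcong (SAdd t u) (SAdd t' u')
| sc_opp t t' : symcong t t' -> symcong (SOpp t) (SOpp t')
| sc_mul t t' u u' :
    symcong t t' -> symcong u u' -> symcong (SMul t u) (SMul t' u')
| sc_addA t u v : symcong (SAdd t (SAdd u v)) (SAdd (SAdd t u) v)
| sc_addC t u : symcong (SAdd t u) (SAdd u t)
| sc_add0 t : symcong (SAdd (SScal 0) t) t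
| sc_addN t : symcong (SAdd (SOpp t) t) (SScal 0)
| sc_mulA t u v : symcong (SMul t (SMul u v)) (SMul (SMul t u) v)
| sc_mul1 t : symcong (SMul (SScal 1) t) t
| sc_mulr1 t : symcong (SMul t (SScal 1)) t
| sc_mulDl t u v : symcong (SMul (SAdd t u) v) (SAdd (SMul t v) (SMul u v))
| sc_mulDr t u v : symcong (SMul t (SAdd u v)) (SAdd (SMul t u) (SMul t v))
| sc_scalD a b : symcong (SScal (a + b)) (SAdd (SScal a) (SScal b))
| sc_scalM a b : symcong (SScal (a * b)) (SMul (SScal a) (SScal b))
| sc_genD m n : symcong (SGen (m + n)) (SAdd (SGen m) (SGen n))
| sc_genZ a m : symcong (SGen (a *: m)) (SMul (SScal a) (SGen m))
| sc_genscal b c a m : homog b a -> homog c m ->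
    symcong (SMul (SGen m) (SScal a)) (ssign (b && c) (SMul (SScal a) (SGen m)))
| sc_gengen b c m n : homog b m -> homog c n ->
    symcong (SMul (SGen m) (SGen n)) (ssign (b && c) (SMul (SGen n) (SGen m))).

HB.instance Definition _ (A M : Type) := gen_eqMixin (symterm A M).
HB.instance Definition _ (A M : Type) := gen_choiceMixin (symterm A M).

Section SymQuotient.
Variables (A : superComRingType) (M : superModType A).

Definition symrel : rel (symterm A M) := fun t u => `[< symcong t u >].

Lemma symrel_refl : reflexive symrel.
Proof. by move=> t; apply/asboolP; apply: sc_refl. Qed.
Lemma symrel_sym : symmetric symrel.
Proof. by move=> t u; apply/asboolP/asboolP; apply: sc_sym. Qed.
Lemma symrel_trans : transitive symrel.
Proof. by move=> t u v /asboolP h1 /asboolP h2; apply/asboolP; apply: sc_trans h1 h2. Qed.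

Canonical symrel_equiv :=
  EquivRel symrel symrel_refl symrel_sym symrel_trans.

Definition Sym : Type := {eq_quot symrel_equiv}.
HB.instance Definition _ := Choice.on Sym.

Definition sympi (t : symterm A M) : Sym := \pi_{eq_quot symrel_equiv} t.
Definition symrepr (x : Sym) : symterm A M := repr (x : {eq_quot symrel_equiv}).

Lemma sympiP t u : symcong t u -> sympi t = sympi u.
Proof. by move=> h; rewrite /sympi; apply/eqmodP/asboolP. Qed.

Lemma sympi_repr x : sympi (symrepr x) = x.
Proof. exact: reprK. Qed.

Lemma repr_sympi t : symcong (symrepr (sympi t)) t.
Proof.
by apply/asboolP/(eqmodP symrel_equiv); apply: sympi_repr.
Qed.

Definition sym_add (x y : Sym) : Sym := sympi (SAdd (symrepr x) (symrepr y)).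
Definition sym_opp (x : Sym) : Sym := sympi (SOpp (symrepr x)).
Definition sym_mul (x y : Sym) : Sym := sympi (SMul (symrepr x) (symrepr y)).
Definition sym_inA (a : A) : Sym := sympi (SScal a).
Definition gen (m : M) : Sym := sympi (SGen m).

Lemma sympiD t u : sympi (SAdd t u) = sym_add (sympi t) (sympi u).
Proof. by apply: sympiP; apply: sc_add; apply: sc_sym; apply: repr_sympi. Qed.
Lemma sympiN t : sympi (SOpp t) = sym_opp (sympi t).
Proof. by apply: sympiP; apply: sc_opp; apply: sc_sym; apply: repr_sympi. Qed.
Lemma sympiM t u : sympi (SMul t u) = sym_mul (sympi t) (sympi u).
Proof. by apply: sympiP; apply: sc_mul; apply: sc_sym; apply: repr_sympi. Qed.

Lemma sym_pi_ind (P : Sym -> Prop) : (forall t, P (sympi t)) -> forall x, P x.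
Proof. by move=> h x; rewrite -(sympi_repr x). Qed.

Fact sym_addA : associative sym_add.
Proof.
elim/sym_pi_ind => t; elim/sym_pi_ind => u; elim/sym_pi_ind => v.
by rewrite -!sympiD; apply: sympiP; apply: sc_addA.
Qed.
Fact sym_addC : commutative sym_add.
Proof.
elim/sym_pi_ind => t; elim/sym_pi_ind => u.
by rewrite -!sympiD; apply: sympiP; apply: sc_addC.
Qed.
Fact sym_add0 : left_id (sym_inA 0) sym_add.
Proof. by elim/sym_pi_ind => t; rewrite -sympiD; apply: sympiP; apply: sc_add0. Qed.
Fact sym_addN : left_inverse (sym_inA 0) sym_opp sym_add.
Proof.
by elim/sym_pi_ind => t; rewrite -sympiN -sympiD; apply: sympiP; apply: sc_addN.
Qed.
HB.instance Definition _ :=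
  GRing.isZmodule.Build Sym sym_addA sym_addC sym_add0 sym_addN.

Fact sym_mulA : associative sym_mul.
Proof.
elim/sym_pi_ind => t; elim/sym_pi_ind => u; elim/sym_pi_ind => v.
by rewrite -!sympiM; apply: sympiP; apply: sc_mulA.
Qed.
Fact sym_mul1 : left_id (sym_inA 1) sym_mul.
Proof. by elim/sym_pi_ind => t; rewrite -sympiM; apply: sympiP; apply: sc_mul1. Qed.
Fact sym_mulr1 : right_id (sym_inA 1) sym_mul.
Proof. by elim/sym_pi_ind => t; rewrite -sympiM; apply: sympiP; apply: sc_mulr1. Qed.
Fact sym_mulDl : left_distributive sym_mul +%R.
Proof.
elim/sym_pi_ind => t; elim/sym_pi_ind => u; elim/sym_pi_ind => v.
by rewrite -[_ + _]sympiD -!sympiM -[RHS]sympiD; apply: sympiP; apply: sc_mulDl.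
Qed.
Fact sym_mulDr : right_distributive sym_mul +%R.
Proof.
elim/sym_pi_ind => t; elim/sym_pi_ind => u; elim/sym_pi_ind => v.
by rewrite -[_ + _]sympiD -!sympiM -[RHS]sympiD; apply: sympiP; apply: sc_mulDr.
Qed.
HB.instance Definition _ := GRing.Zmodule_isPzRing.Build Sym
  sym_mulA sym_mul1 sym_mulr1 sym_mulDl sym_mulDr.

Lemma sympi_add t u : sympi (SAdd t u) = sympi t + sympi u.
Proof. exact: sympiD. Qed.
Lemma sympi_opp t : sympi (SOpp t) = - sympi t.
Proof. exact: sympiN. Qed.
Lemma sympi_mul t u : sympi (SMul t u) = sympi t * sympi u.
Proof. exact: sympiM. Qed.
Lemma sympi_sign b t : sympi (ssign b t) = (-1) ^+ b * sympi t.
Proof. by case: b; rewrite /= ?expr1 ?expr0 ?mul1r // sympi_opp mulN1r. Qed.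

Lemma sym_inAD a b : sym_inA (a + b) = sym_inA a + sym_inA b.
Proof. by rewrite -[RHS]sympi_add; apply: sympiP; apply: sc_scalD. Qed.
Lemma sym_inAM a b : sym_inA (a * b) = sym_inA a * sym_inA b.
Proof. by rewrite -[RHS]sympi_mul; apply: sympiP; apply: sc_scalM. Qed.
Lemma sym_inA1 : sym_inA 1 = 1. Proof. by []. Qed.
Lemma sym_inA0 : sym_inA 0 = 0. Proof. by []. Qed.

Lemma genD m n : gen (m + n) = gen m + gen n.
Proof. by rewrite -[RHS]sympi_add; apply: sympiP; apply: sc_genD. Qed.
Lemma gen0 : gen 0 = 0.
Proof. by apply: (addrI (gen 0)); rewrite -genD !addr0. Qed.
Lemma sym_genZ a m : gen (a *: m) = sym_inA a * gen m.
Proof. by rewrite -[RHS]sympi_mul; apply: sympiP; apply: sc_genZ. Qed.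
Lemma sym_gen_inA b c a m : homog b a -> homog c m ->
  gen m * sym_inA a = (-1) ^+ (b && c) * (sym_inA a * gen m).
Proof.
move=> ha hm; rewrite -[_ * sym_inA a]sympi_mul -[sym_inA a * _]sympi_mul -sympi_sign.
by apply: sympiP; apply: sc_genscal.
Qed.
Lemma gen_supermulC b c m n : homog b m -> homog c n ->
  gen m * gen n = (-1) ^+ (b && c) * (gen n * gen m).
Proof.
move=> hm hn; rewrite -[gen m * _]sympi_mul -[gen n * _]sympi_mul -sympi_sign.
by apply: sympiP; apply: sc_gengen.
Qed.

Lemma sym_ind (P : Sym -> Prop) :
  (forall a, P (sym_inA a)) -> (forall m, P (gen m)) ->
  (forall x y, P x -> P y -> P (x + y)) -> (forall x, P x -> P (- x)) ->
  (forall x y, P x -> P y -> P (x * y)) -> forall x, P x.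
Proof.
move=> Pa Pm PD PN PM; elim/sym_pi_ind.
elim=> [a|m|t ht u hu|t ht|t ht u hu].
- exact: Pa.
- exact: Pm.
- by rewrite sympi_add; apply: PD.
- by rewrite sympi_opp; apply: PN.
- by rewrite sympi_mul; apply: PM.
Qed.

(* Parity of the symmetric algebra: a and m keep their parity, and
   (t u)_b = sum_c t_c u_(c+b). *)
Fixpoint symterm_proj (b : bool) (t : symterm A M) : Sym :=
  match t with
  | SScal a => sym_inA (hproj b a)
  | SGen m => gen (hproj b m)
  | SAdd t u => symterm_proj b t + symterm_proj b u
  | SOpp t => - symterm_proj b t
  | SMul t u => symterm_proj false t * symterm_proj b u
              + symterm_proj true t * symterm_proj (~~ b) u
  end.

Definition sym_proj (b : bool) (x : Sym) : Sym := symterm_proj b (symrepr x).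

Lemma symterm_proj_sign b e t :
  symterm_proj b (ssign e t) = (-1) ^+ e * symterm_proj b t.
Proof. by case: e => /=; rewrite ?expr1 ?expr0 ?mul1r ?mulN1r. Qed.

Lemma symterm_projP t u : symcong t u ->
  forall b, symterm_proj b t = symterm_proj b u.
Proof.
elim=> {t u} /=.
- by [].
- by move=> t u _ h b; rewrite h.
- by move=> t u v _ h1 _ h2 b; rewrite h1 h2.
- by move=> t t' u u' _ h1 _ h2 b; rewrite h1 h2.
- by move=> t t' _ h b; rewrite h.
- by move=> t t' u u' _ h1 _ h2 b; rewrite !h1 !h2.
- by move=> t u v b; rewrite addrA.
- by move=> t u b; rewrite addrC.
- by move=> t b; rewrite hproj0 sym_inA0 add0r.
- by move=> t b; rewrite hproj0 sym_inA0 addNr.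
- move=> t u v b; rewrite !mulrDr !mulrDl !mulrA -!addrA; congr (_ + _).
  by rewrite [in RHS]addrCA; congr (_ + _); rewrite addrC negbK.
- move=> t b; rewrite !(homog_proj _ (@homog1 A)) /=.
  by rewrite sym_inA0 mul0r addr0 sym_inA1 mul1r.
- move=> t b; rewrite !(homog_proj _ (@homog1 A)).
  by case: b; rewrite /= sym_inA0 mulr0 ?addr0 ?add0r sym_inA1 mulr1.
- by move=> t u v b; rewrite !mulrDl addrACA.
- by move=> t u v b; rewrite !mulrDr addrACA.
- by move=> a c b; rewrite hprojD sym_inAD.
- move=> a c b; rewrite -!sym_inAM -sym_inAD; congr sym_inA.
  rewrite -{1}(hproj_sum a) -{1}(hproj_sum c) !mulrDl !mulrDr !hprojD.
  by rewrite !(homog_proj _ (homogM (hproj_homog _ _) (hproj_homog _ _)));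
    case: b => /=; rewrite ?addr0 ?add0r.
- by move=> m n b; rewrite hprojD genD.
- move=> a m b; rewrite -!sym_genZ -genD; congr gen.
  rewrite -{1}(hproj_sum a) -{1}(hproj_sum m) !scalerDl !scalerDr !hprojD.
  by rewrite !(homog_proj _ (homogZ (hproj_homog _ _) (hproj_homog _ _)));
    case: b => /=; rewrite ?addr0 ?add0r.
- move=> b c a m ha hm d; rewrite symterm_proj_sign /=.
  rewrite !(homog_proj _ ha) !(homog_proj _ hm).
  case: b c d ha hm => [] [] [] ha hm /=;
  rewrite ?gen0 ?sym_inA0 ?(mulr0, mul0r, addr0, add0r) //;
  by rewrite (sym_gen_inA ha hm).
- move=> b c m n hm hn d; rewrite symterm_proj_sign /=.
  rewrite !(homog_proj _ hm) !(homog_proj _ hn).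
  case: b c d hm hn => [] [] [] hm hn /=;
  rewrite ?gen0 ?(mulr0, mul0r, addr0, add0r) //;
  by rewrite (gen_supermulC hm hn).
Qed.

Lemma sym_proj_pi b t : sym_proj b (sympi t) = symterm_proj b t.
Proof. by apply: symterm_projP; apply: repr_sympi. Qed.

Lemma sym_projD b x y : sym_proj b (x + y) = sym_proj b x + sym_proj b y.
Proof.
elim/sym_pi_ind: x => t; elim/sym_pi_ind: y => u.
by rewrite -sympi_add !sym_proj_pi.
Qed.

Lemma sym_projN b x : sym_proj b (- x) = - sym_proj b x.
Proof. by elim/sym_pi_ind: x => t; rewrite -sympi_opp !sym_proj_pi. Qed.

Lemma sym_projM b x y : sym_proj b (x * y) =
  sym_proj false x * sym_proj b y + sym_proj true x * sym_proj (~~ b) y.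
Proof.
elim/sym_pi_ind: x => t; elim/sym_pi_ind: y => u.
by rewrite -sympi_mul !sym_proj_pi.
Qed.

Lemma sym_proj_inA b a : sym_proj b (sym_inA a) = sym_inA (hproj b a).
Proof. exact: sym_proj_pi. Qed.

Lemma sym_proj_gen b m : sym_proj b (gen m) = gen (hproj b m).
Proof. exact: sym_proj_pi. Qed.

Lemma sym_projK b c x :
  sym_proj b (sym_proj c x) = if b == c then sym_proj c x else 0.
Proof.
elim/sym_ind: x b c => [a|m|x y hx hy|x hx|x y hx hy] b c.
- by rewrite !sym_proj_inA hprojK; case: ifP; rewrite ?sym_inA0.
- by rewrite !sym_proj_gen hprojK; case: ifP; rewrite ?gen0.
- by rewrite !sym_projD hx hy; case: ifP; rewrite ?addr0.
- by rewrite !sym_projN hx; case: ifP; rewrite ?oppr0.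
- rewrite !sym_projM !sym_projD !sym_projM !hx !hy.
  by case: b c => [] [] /=; rewrite ?(mulr0, mul0r, addr0, add0r).
Qed.

Lemma sym_proj_sum x : sym_proj false x + sym_proj true x = x.
Proof.
elim/sym_ind: x => [a|m|x y hx hy|x hx|x y hx hy].
- by rewrite !sym_proj_inA -sym_inAD hproj_sum.
- by rewrite !sym_proj_gen -genD hproj_sum.
- by rewrite !sym_projD addrACA hx hy.
- by rewrite !sym_projN -opprD hx.
- rewrite !sym_projM /= -[in RHS]hx -[in RHS]hy mulrDl !mulrDr.
  by rewrite addrACA [X in _ + X]addrC.
Qed.

HB.instance Definition _ := isSuperZmodule.Build Sym sym_projD sym_projK sym_proj_sum.

Fact sym_homog1 : homog false (1 : Sym).
Proof. by rewrite /homog -sym_inA1 /hproj /= sym_proj_inA (homog1 : hproj _ _ = _). Qed.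

Fact sym_homogM b c (x y : Sym) :
  homog b x -> homog c y -> homog (b (+) c) (x * y).
Proof.
move=> hx hy; rewrite /homog [LHS]sym_projM.
rewrite -![sym_proj _ x]/(hproj _ x) -![sym_proj _ y]/(hproj _ y).
rewrite !(homog_proj _ hx) !(homog_proj _ hy).
by case: b c {hx hy} => [] [] /=; rewrite ?(mulr0, mul0r, addr0, add0r).
Qed.

HB.instance Definition _ := isSuperRing.Build Sym sym_homog1 sym_homogM.

Fact sym_homog_inA b a : homog b a -> homog b (sym_inA a).
Proof. by move=> ha; rewrite /homog [LHS]sym_proj_inA (ha : hproj _ _ = _). Qed.

Lemma homog_gen b m : homog b m -> homog b (gen m).
Proof. by move=> hm; rewrite /homog [LHS]sym_proj_gen (hm : hproj _ _ = _). Qed.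

Fact sym_inA_sginv b a : sym_inA (sginv b a) = sginv b (sym_inA a).
Proof.
elim/homog_ind: a => [x y hx hy|c a ha].
  by rewrite !(sginvD, sym_inAD) hx hy.
rewrite (sginv_homog _ ha) (sginv_homog _ (sym_homog_inA ha)).
case: ifP => // _; apply/eqP.
by rewrite -addr_eq0 -sym_inAD addNr sym_inA0.
Qed.

Fact sym_comm_inA b a (x : Sym) : homog b a ->
  x * sym_inA a = sym_inA a * sginv b x.
Proof.
move=> ha; elim/sym_ind: x => [c|m|x y hx hy|x hx|x y hx hy].
- rewrite -sym_inA_sginv -!sym_inAM; congr sym_inA.
  elim/homog_ind: c => [x y hx hy|d c hc]; first by rewrite mulrDl hx hy -mulrDr -sginvD.
  rewrite (supermulC hc ha) (sginv_homog _ hc) andbC.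
  by case: ifP; rewrite ?mul1r // expr1 mulN1r mulrN.
- elim/homog_ind: m => [x y hx hy|d c hc].
    by rewrite genD mulrDl hx hy -mulrDr -sginvD.
  rewrite (sym_gen_inA ha hc) (sginv_homog _ (homog_gen hc)).
  by case: ifP; rewrite ?mul1r // expr1 mulN1r mulrN.
- by rewrite mulrDl hx hy sginvD mulrDr.
- by rewrite mulNr hx sginvN mulrN.
- by rewrite -mulrA hy mulrA hx -mulrA -sginvM.
Qed.

Fact sym_inA_central b c a (s : Sym) : homog b a -> homog c s ->
  s * sym_inA a = (-1) ^+ (b && c) * (sym_inA a * s).
Proof.
move=> ha hs; rewrite (sym_comm_inA _ ha) (sginv_homog _ hs).
by case: ifP; rewrite ?mul1r // expr1 mulN1r mulrN.
Qed.

HB.instance Definition _ := isSuperAlgOver.Build A Sym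
  sym_inAD sym_inAM sym_inA1 sym_homog_inA sym_inA_central.

Lemma genZ (a : A) m : gen (a *: m) = inA a * gen m.
Proof. exact: sym_genZ. Qed.

(* The k-th symmetric power, as the A-submodule of Sym M spanned by the
   k-fold products of elements of M. *)
Definition symk (k : nat) : set Sym := fun s : Sym =>
  exists (n : nat) (a : 'I_n -> A) (m : 'I_n -> 'I_k -> M),
    s = \sum_(i < n) inA (a i) * \prod_(j < k) gen (m i j).

(* The superderivation of Sym M of parity g extending a superlinear functional
   phi of parity g on M: D(a) = 0, D(m) = phi m,
   D(t u) = D(t) u + (-1)^{g|t|} t D(u). *)
Fixpoint symterm_deriv (g : bool) (phi : M -> A) (t : symterm A M) : Sym :=
  match t with
  | SScal _ => 0
  | SGen m => inA (phi m)
  | SAdd t u => symterm_deriv g phi t + symterm_deriv g phi u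
  | SOpp t => - symterm_deriv g phi t
  | SMul t u => symterm_deriv g phi t * sympi u
              + sginv g (sympi t) * symterm_deriv g phi u
  end.

Definition symderiv (g : bool) (phi : M -> A) (x : Sym) : Sym :=
  symterm_deriv g phi (symrepr x).

Definition superfunctional (g : bool) (phi : M -> A) : Prop :=
  [/\ forall m n, phi (m + n) = phi m + phi n,
      forall a m, phi (a *: m) = sginv g a * phi m
    & forall b m, homog b m -> homog (b (+) g) (phi m)].

Section Deriv.
Variables (g : bool) (phi : M -> A).
Hypothesis phiP : superfunctional g phi.
Let D := symterm_deriv g phi.

Lemma symterm_derivP t u : symcong t u -> D t = D u.
Proof.
have [phiD phiZ phih] := phiP; rewrite /D.
have Dsign b v : symterm_deriv g phi (ssign b v) = (-1) ^+ b * symterm_deriv g phi v.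
  by case: b => /=; rewrite ?expr1 ?expr0 ?mul1r ?mulN1r.
elim=> {t u} /=.
- by [].
- by [].
- by move=> t u v _ -> _ ->.
- by move=> t t' u u' _ -> _ ->.
- by move=> t t' _ ->.
- by move=> t t' u u' /sympiP-> -> /sympiP-> ->.
- by move=> t u v; rewrite addrA.
- by move=> t u; rewrite addrC.
- by move=> t; rewrite add0r.
- by move=> t; rewrite addNr.
- by move=> t u v; rewrite !sympi_mul sginvM !mulrDl !mulrDr !mulrA addrA.
- by move=> t; rewrite mul0r add0r [sympi _]sym_inA1 sginv1 mul1r.
- by move=> t; rewrite mulr0 addr0 [sympi _]sym_inA1 mulr1.
- by move=> t u v; rewrite sympi_add sginvD !mulrDl addrACA.
- by move=> t u v; rewrite sympi_add !mulrDr addrACA.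
- by move=> *; rewrite addr0.
- by move=> *; rewrite mul0r mulr0 addr0.
- by move=> m n; rewrite phiD inAD.
- by move=> a m; rewrite mul0r add0r phiZ inAM inA_sginv.
- move=> b c a m ha hm; rewrite Dsign /= mulr0 addr0 mul0r add0r.
  rewrite (_ : sympi (SScal a) = inA a) // -inA_sginv -!inAM (supermulC (phih _ _ hm) ha) inAM.
  rewrite (sginv_homog _ ha) andbC.
  case: g b c {ha hm} => [] [] []; rewrite /= ?expr1 ?expr0 ?(inAN, inA1, mulN1r, mul1r);
  by rewrite ?(mulNr, inAM) ?opprK.
- move=> b c m n hm hn; rewrite Dsign /= -/(gen m) -/(gen n).
  rewrite (sginv_homog _ (homog_gen hm)) (sginv_homog _ (homog_gen hn)).
  have E u v d e : homog d u -> homog e v ->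
      gen v * inA (phi u) = (-1) ^+ ((d (+) g) && e) * (inA (phi u) * gen v).
    by move=> hu hv; exact: inA_central (phih _ _ hu) (homog_gen hv).
  have {}E1 := E _ _ _ _ hm hn; have {E}E2 := E _ _ _ _ hn hm.
  case: (g) b c hm hn E1 E2 => [] [] [] hm hn /=;
  rewrite ?expr1 ?expr0 ?(mulN1r, mul1r, mulNr) => -> ->;
  by rewrite ?opprD ?opprK addrC.
Qed.

Lemma symderiv_pi t : symderiv g phi (sympi t) = D t.
Proof. by apply: symterm_derivP; apply: repr_sympi. Qed.

Lemma symderivD x y :
  symderiv g phi (x + y) = symderiv g phi x + symderiv g phi y.
Proof.
elim/sym_pi_ind: x => t; elim/sym_pi_ind: y => u.
by rewrite -sympi_add !symderiv_pi.
Qed.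

Lemma symderiv_inA a : symderiv g phi (inA a) = 0.
Proof. exact: symderiv_pi. Qed.

Lemma symderiv_gen m : symderiv g phi (gen m) = inA (phi m).
Proof. exact: symderiv_pi. Qed.

Lemma symderivM x y : symderiv g phi (x * y) =
  symderiv g phi x * y + sginv g x * symderiv g phi y.
Proof.
elim/sym_pi_ind: x => t; elim/sym_pi_ind: y => u.
by rewrite -sympi_mul !symderiv_pi.
Qed.

Lemma symderivZ a x :
  symderiv g phi (inA a * x) = inA (sginv g a) * symderiv g phi x.
Proof. by rewrite symderivM symderiv_inA mul0r add0r inA_sginv. Qed.

End Deriv.
End SymQuotient.

Arguments sym_inA {A M} a.
Arguments gen {A M} m.

(* Tensor product over A of two A-superalgebras: the abelian group presented by
   the symbols r (x) s, additive in r and s, with (r a) (x) s = r (x) (a s),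
   where r a = r * inA a and a s = inA a * s. *)

Inductive tensterm (R S : Type) : Type :=
| TZero
| TPure of R & S
| TAdd of tensterm R S & tensterm R S
| TOpp of tensterm R S.
Arguments TZero {R S}.

Inductive tenscong (A : superComRingType) (R S : superAlgOverType A) :
    tensterm R S -> tensterm R S -> Prop :=
| tc_refl t : tenscong t t
| tc_sym t u : tenscong t u -> tenscong u t
| tc_trans t u v : tenscong t u -> tenscong u v -> tenscong t v
| tc_add t t' u u' :
    tenscong t t' -> tenscong u u' -> tenscong (TAdd t u) (TAdd t' u')
| tc_opp t t' : tenscong t t' -> tenscong (TOpp t) (TOpp t')
| tc_addA t u v : tenscong (TAdd t (TAdd u v)) (TAdd (TAdd t u) v)
| tc_addC t u : tenscong (TAdd t u) (TAdd u t)
| tc_add0 t : tenscong (TAdd TZero t) t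
| tc_addN t : tenscong (TAdd (TOpp t) t) TZero
| tc_pureDl r r' s :
    tenscong (TPure (r + r') s) (TAdd (TPure r s) (TPure r' s))
| tc_pureDr r s s' :
    tenscong (TPure r (s + s')) (TAdd (TPure r s) (TPure r s'))
| tc_pureA r a s : tenscong (TPure (r * inA a) s) (TPure r (inA a * s)).

HB.instance Definition _ (R S : Type) := gen_eqMixin (tensterm R S).
HB.instance Definition _ (R S : Type) := gen_choiceMixin (tensterm R S).

Section Tensor.
Variables (A : superComRingType) (R S : superAlgOverType A).

Definition tensrel : rel (tensterm R S) := fun t u => `[< tenscong t u >].

Lemma tensrel_refl : reflexive tensrel.
Proof. by move=> t; apply/asboolP; apply: tc_refl. Qed.
Lemma tensrel_sym : symmetric tensrel.
Proof. by move=> t u; apply/asboolP/asboolP; apply: tc_sym. Qed.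
Lemma tensrel_trans : transitive tensrel.
Proof. by move=> t u v /asboolP h1 /asboolP h2; apply/asboolP; apply: tc_trans h1 h2. Qed.

Canonical tensrel_equiv :=
  EquivRel tensrel tensrel_refl tensrel_sym tensrel_trans.

Definition Tens : Type := {eq_quot tensrel_equiv}.
HB.instance Definition _ := Choice.on Tens.

Definition tenspi (t : tensterm R S) : Tens := \pi_{eq_quot tensrel_equiv} t.
Definition tensrepr (x : Tens) : tensterm R S := repr (x : {eq_quot tensrel_equiv}).

Lemma tenspiP t u : tenscong t u -> tenspi t = tenspi u.
Proof. by move=> h; rewrite /tenspi; apply/eqmodP/asboolP. Qed.

Lemma tenspi_repr x : tenspi (tensrepr x) = x.
Proof. exact: reprK. Qed.

Lemma repr_tenspi t : tenscong (tensrepr (tenspi t)) t.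
Proof. by apply/asboolP/(eqmodP tensrel_equiv); apply: tenspi_repr. Qed.

Definition tens_add (x y : Tens) : Tens := tenspi (TAdd (tensrepr x) (tensrepr y)).
Definition tens_opp (x : Tens) : Tens := tenspi (TOpp (tensrepr x)).
Definition tens_zero : Tens := tenspi TZero.
Definition tens (r : R) (s : S) : Tens := tenspi (TPure r s).

Lemma tenspiD t u : tenspi (TAdd t u) = tens_add (tenspi t) (tenspi u).
Proof. by apply: tenspiP; apply: tc_add; apply: tc_sym; apply: repr_tenspi. Qed.
Lemma tenspiN t : tenspi (TOpp t) = tens_opp (tenspi t).
Proof. by apply: tenspiP; apply: tc_opp; apply: tc_sym; apply: repr_tenspi. Qed.

Lemma tens_pi_ind (P : Tens -> Prop) : (forall t, P (tenspi t)) -> forall x, P x.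
Proof. by move=> h x; rewrite -(tenspi_repr x). Qed.

Fact tens_addA : associative tens_add.
Proof.
elim/tens_pi_ind => t; elim/tens_pi_ind => u; elim/tens_pi_ind => v.
by rewrite -!tenspiD; apply: tenspiP; apply: tc_addA.
Qed.
Fact tens_addC : commutative tens_add.
Proof.
elim/tens_pi_ind => t; elim/tens_pi_ind => u.
by rewrite -!tenspiD; apply: tenspiP; apply: tc_addC.
Qed.
Fact tens_add0 : left_id tens_zero tens_add.
Proof. by elim/tens_pi_ind => t; rewrite -tenspiD; apply: tenspiP; apply: tc_add0. Qed.
Fact tens_addN : left_inverse tens_zero tens_opp tens_add.
Proof.
by elim/tens_pi_ind => t; rewrite -tenspiN -tenspiD; apply: tenspiP; apply: tc_addN.
Qed.
HB.instance Definition _ :=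
  GRing.isZmodule.Build Tens tens_addA tens_addC tens_add0 tens_addN.

Lemma tenspi_add t u : tenspi (TAdd t u) = tenspi t + tenspi u.
Proof. exact: tenspiD. Qed.
Lemma tenspi_opp t : tenspi (TOpp t) = - tenspi t.
Proof. exact: tenspiN. Qed.

Lemma tensDl r r' s : tens (r + r') s = tens r s + tens r' s.
Proof. by rewrite -[RHS]tenspi_add; apply: tenspiP; apply: tc_pureDl. Qed.
Lemma tensDr r s s' : tens r (s + s') = tens r s + tens r s'.
Proof. by rewrite -[RHS]tenspi_add; apply: tenspiP; apply: tc_pureDr. Qed.
Lemma tensA r a s : tens (r * inA a) s = tens r (inA a * s).
Proof. by apply: tenspiP; apply: tc_pureA. Qed.

Lemma tens0l s : tens 0 s = 0.
Proof. by apply: (addrI (tens 0 s)); rewrite -tensDl !addr0. Qed.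
Lemma tens0r r : tens r 0 = 0.
Proof. by apply: (addrI (tens r 0)); rewrite -tensDr !addr0. Qed.
Lemma tensNl r s : tens (- r) s = - tens r s.
Proof. by apply/eqP; rewrite -addr_eq0 -tensDl addNr tens0l. Qed.
Lemma tensNr r s : tens r (- s) = - tens r s.
Proof. by apply/eqP; rewrite -addr_eq0 -tensDr addNr tens0r. Qed.

Lemma tens_ind (P : Tens -> Prop) :
  (forall x y, P x -> P y -> P (x + y)) ->
  (forall r s, P (tens r s)) -> forall x, P x.
Proof.
move=> PD Pt; elim/tens_pi_ind.
have: forall t, P (tenspi t) /\ P (tenspi (TOpp t)).
  elim=> [|r s|t [h1 h2] u [h3 h4]|t [h1 h2]].
  - by rewrite tenspi_opp (_ : tenspi TZero = 0) // oppr0 -(tens0l 0); split; apply: Pt.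
  - by rewrite tenspi_opp -[- _](tensNl r s); split; apply: Pt.
  - rewrite tenspi_opp tenspi_add opprD -!tenspi_opp.
    by split; apply: PD.
  - by rewrite (tenspi_opp (TOpp t)) tenspi_opp opprK -tenspi_opp.
by move=> h t; case: (h t).
Qed.

Lemma tens_homog_ind (P : Tens -> Prop) :
  (forall x y, P x -> P y -> P (x + y)) ->
  (forall b c r s, homog b r -> homog c s -> P (tens r s)) -> forall x, P x.
Proof.
move=> PD Ph; apply: tens_ind => // r s.
elim/homog_ind: r => [r r' h h'|b r hr]; first by rewrite tensDl; apply: PD.
elim/homog_ind: s => [s s' h h'|c s hs]; first by rewrite tensDr; apply: PD.
exact: Ph hr hs.
Qed.

(* The additive map out of the tensor product induced by f : R -> S -> Z; it is
   meaningful when f is biadditive and A-balanced. *)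
Fixpoint tensterm_lift (Z : zmodType) (f : R -> S -> Z) (t : tensterm R S) : Z :=
  match t with
  | TZero => 0
  | TPure r s => f r s
  | TAdd t u => tensterm_lift f t + tensterm_lift f u
  | TOpp t => - tensterm_lift f t
  end.

Definition tens_lift (Z : zmodType) (f : R -> S -> Z) (x : Tens) : Z :=
  tensterm_lift f (tensrepr x).

Definition balanced (Z : zmodType) (f : R -> S -> Z) : Prop :=
  [/\ forall r r' s, f (r + r') s = f r s + f r' s,
      forall r s s', f r (s + s') = f r s + f r s'
    & forall r a s, f (r * inA a) s = f r (inA a * s)].

Section Lift.
Variables (Z : zmodType) (f : R -> S -> Z).
Hypothesis fP : balanced f.

Lemma tens_lift_pi t : tens_lift f (tenspi t) = tensterm_lift f t.
Proof.
have [fDl fDr fA] := fP.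
suff h t' u : tenscong t' u -> tensterm_lift f t' = tensterm_lift f u.
  by apply: h; apply: repr_tenspi.
elim=> {t t' u} //=.
- by move=> t u v _ -> _ ->.
- by move=> t t' u u' _ -> _ ->.
- by move=> t t' _ ->.
- by move=> t u v; rewrite addrA.
- by move=> t u; rewrite addrC.
- by move=> t; rewrite add0r.
- by move=> t; rewrite addNr.
Qed.

Lemma tens_liftE r s : tens_lift f (tens r s) = f r s.
Proof. exact: tens_lift_pi. Qed.

Lemma tens_liftD x y : tens_lift f (x + y) = tens_lift f x + tens_lift f y.
Proof.
elim/tens_pi_ind: x => t; elim/tens_pi_ind: y => u.
by rewrite -tenspi_add !tens_lift_pi.
Qed.
End Lift.

(* (r (x) s)_b = sum_c r_c (x) s_(c+b) *)
Definition tens_proj (b : bool) : Tens -> Tens :=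
  tens_lift (fun r s =>
    tens (hproj false r) (hproj b s) + tens (hproj true r) (hproj (~~ b) s)).

Lemma hproj_mulr_inA b (r : R) c a : homog c a ->
  hproj b (r * inA a) = hproj (b (+) c) r * inA a.
Proof.
move=> ha; elim/homog_ind: r => [r r' h h'|d r hr].
  by rewrite mulrDl !hprojD mulrDl h h'.
rewrite (homog_proj _ hr) (homog_proj _ (homogM hr (homog_inA ha))).
by case: b c d {hr ha} => [] [] []; rewrite /= ?mul0r.
Qed.

Lemma hproj_mull_inA b (s : S) c a : homog c a ->
  hproj b (inA a * s) = inA a * hproj (b (+) c) s.
Proof.
move=> ha; elim/homog_ind: s => [r r' h h'|d r hr].
  by rewrite mulrDr !hprojD mulrDr h h'.
rewrite (homog_proj _ hr) (homog_proj _ (homogM (homog_inA ha) hr)).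
by case: b c d {hr ha} => [] [] []; rewrite /= ?mulr0.
Qed.

Fact tens_proj_balanced b : balanced (fun r s =>
  tens (hproj false r) (hproj b s) + tens (hproj true r) (hproj (~~ b) s)).
Proof.
split=> [r r' s|r s s'|r a s].
- by rewrite !hprojD !tensDl addrACA.
- by rewrite !hprojD !tensDr addrACA.
elim/homog_ind: a => [a a' h h'|c a ha].
  by rewrite !inAD mulrDr mulrDl !hprojD !tensDl !tensDr addrACA h h' addrACA.
rewrite !(hproj_mulr_inA _ _ ha) !(hproj_mull_inA _ _ ha) !tensA.
by case: b c {ha} => [] [] //=; rewrite addrC.
Qed.

Lemma tens_projE b r s : tens_proj b (tens r s) =
  tens (hproj false r) (hproj b s) + tens (hproj true r) (hproj (~~ b) s).
Proof. exact: (tens_liftE (tens_proj_balanced b)). Qed.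

Fact tens_projD b x y : tens_proj b (x + y) = tens_proj b x + tens_proj b y.
Proof. exact: (tens_liftD (tens_proj_balanced b)). Qed.

Lemma tens_proj_homog b c d r s : homog c r -> homog d s ->
  tens_proj b (tens r s) = if b == c (+) d then tens r s else 0.
Proof.
move=> hr hs; rewrite tens_projE !(homog_proj _ hr) !(homog_proj _ hs).
by case: b c d {hr hs} => [] [] []; rewrite /= ?(tens0l, tens0r, addr0, add0r).
Qed.

Lemma tens_proj0 b : tens_proj b 0 = 0.
Proof. by apply: (addrI (tens_proj b 0)); rewrite -tens_projD !addr0. Qed.

Fact tens_projK b c x :
  tens_proj b (tens_proj c x) = if b == c then tens_proj c x else 0.
Proof.
elim/tens_homog_ind: x => [x y h h'|d e r s hr hs].
  by rewrite !tens_projD h h'; case: ifP; rewrite ?addr0.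
rewrite (tens_proj_homog c hr hs).
case: ifP => [/eqP->|_]; last by rewrite tens_proj0 if_same.
exact: tens_proj_homog hr hs.
Qed.

Fact tens_proj_sum x : tens_proj false x + tens_proj true x = x.
Proof.
elim/tens_homog_ind: x => [x y h h'|d e r s hr hs].
  by rewrite !tens_projD addrACA h h'.
by rewrite !(tens_proj_homog _ hr hs); case: (d (+) e); rewrite /= ?addr0 ?add0r.
Qed.

HB.instance Definition _ :=
  isSuperZmodule.Build Tens tens_projD tens_projK tens_proj_sum.

Lemma homog_tens b c r s : homog b r -> homog c s -> homog (b (+) c) (tens r s).
Proof. by move=> hr hs; rewrite /homog [LHS](tens_proj_homog _ hr hs) eqxx. Qed.

(* (r (x) s) (r' (x) s') = (-1)^{|s||r'|} r r' (x) s s' *)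
Definition tens_mul1 (r : R) (s : S) (r' : R) (s' : S) : Tens :=
  tens (r * hproj false r') (s * s') + tens (r * hproj true r') (ginv s * s').
Definition tens_mul (x y : Tens) : Tens :=
  tens_lift (fun r s => tens_lift (tens_mul1 r s) y) x.

Lemma tens_mul1_homog r s b r' s' : homog b r' ->
  tens_mul1 r s r' s' = tens (r * r') (sginv b s * s').
Proof.
move=> hr; rewrite /tens_mul1 !(homog_proj _ hr).
by case: b hr => _ /=; rewrite !mulr0 !tens0l ?addr0 ?add0r.
Qed.

Fact tens_mul1Dl r r1 s r' s' :
  tens_mul1 (r + r1) s r' s' = tens_mul1 r s r' s' + tens_mul1 r1 s r' s'.
Proof. by rewrite /tens_mul1 !mulrDl !tensDl addrACA. Qed.
Fact tens_mul1Dr r s s1 r' s' :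
  tens_mul1 r (s + s1) r' s' = tens_mul1 r s r' s' + tens_mul1 r s1 r' s'.
Proof. by rewrite /tens_mul1 ginvD !mulrDl !tensDr addrACA. Qed.
Fact tens_mul1A r a s r' s' :
  tens_mul1 (r * inA a) s r' s' = tens_mul1 r (inA a * s) r' s'.
Proof.
elim/homog_ind: r' => [r1 r2 h h'|b r' hr'].
  have E t u x y : tens_mul1 t u (x + y) s' = tens_mul1 t u x s' + tens_mul1 t u y s'.
    by rewrite /tens_mul1 !hprojD !mulrDr !tensDl addrACA.
  by rewrite !E h h'.
rewrite !(tens_mul1_homog _ _ _ hr') sginvM -inA_sginv -!mulrA -tensA -mulrA.
congr tens; congr (_ * _).
elim/homog_ind: a => [a a' h h'|c a ha].
  by rewrite sginvD !inAD mulrDl mulrDr h h'.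
rewrite (sginv_homog _ ha); have := inA_central ha hr'.
by rewrite andbC; case: ifP => _; rewrite ?inAN ?mulrN => ->;
  rewrite ?expr0 ?mul1r // expr1 mulN1r opprK.
Qed.
Fact tens_mul1_balanced r s : balanced (tens_mul1 r s).
Proof.
split=> [r' r1 s'|r' s' s1|r' a s'].
- by rewrite /tens_mul1 !hprojD !mulrDr !tensDl addrACA.
- by rewrite /tens_mul1 !mulrDr !tensDr addrACA.
elim/homog_ind: r' => [r1 r2 h h'|b r' hr'].
  have E x y t : tens_mul1 r s (x + y) t = tens_mul1 r s x t + tens_mul1 r s y t.
    by rewrite /tens_mul1 !hprojD !mulrDr !tensDl addrACA.
  by rewrite mulrDl !E h h'.
elim/homog_ind: a => [a a' h h'|c a ha].
  have E x y t : tens_mul1 r s (x + y) t = tens_mul1 r s x t + tens_mul1 r s y t.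
    by rewrite /tens_mul1 !hprojD !mulrDr !tensDl addrACA.
  have E' x y t : tens_mul1 r s t (x + y) = tens_mul1 r s t x + tens_mul1 r s t y.
    by rewrite /tens_mul1 !mulrDr !tensDr addrACA.
  by rewrite !inAD mulrDr mulrDl E E' h h'.
rewrite (tens_mul1_homog _ _ _ hr').
rewrite (tens_mul1_homog _ _ _ (homogM hr' (homog_inA ha))).
rewrite [r * (_ * _)]mulrA tensA !mulrA; congr tens; congr (_ * _).
elim/homog_ind: s => [s s1 h h'|d s hs].
  by rewrite !sginvD mulrDl mulrDr h h'.
rewrite (inA_central ha (homog_sginv _ hs)) !(sginv_homog _ hs).
by case: b c d {hr' ha hs} => [] [] [] /=;
   rewrite ?expr1 ?expr0 ?mulN1r ?mul1r ?mulrN ?opprK.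
Qed.

Fact tens_mul_balanced y : balanced (fun r s => tens_lift (tens_mul1 r s) y).
Proof.
have E r s x z := @tens_liftD _ _ (tens_mul1_balanced r s) x z.
have E' r s := tens_liftE (tens_mul1_balanced r s).
split=> [r r1 s|r s s1|r a s]; elim/tens_ind: y => [x z h h'|r' s'].
- by rewrite !E h h' addrACA.
- by rewrite !E' tens_mul1Dl.
- by rewrite !E h h' addrACA.
- by rewrite !E' tens_mul1Dr.
- by rewrite !E h h'.
- by rewrite !E' tens_mul1A.
Qed.

Lemma tens_mulE r s b r' s' : homog b r' ->
  tens_mul (tens r s) (tens r' s') = tens (r * r') (sginv b s * s').
Proof.
move=> hr'; rewrite [LHS](tens_liftE (tens_mul_balanced _)).
by rewrite (tens_liftE (tens_mul1_balanced _ _)) (tens_mul1_homog _ _ _ hr').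
Qed.

Fact tens_mulDl : left_distributive tens_mul +%R.
Proof. by move=> x y z; apply: (tens_liftD (tens_mul_balanced _)). Qed.
Fact tens_mulDr : right_distributive tens_mul +%R.
Proof.
move=> x y z; elim/tens_ind: x => [u v h h'|r s].
  by rewrite !tens_mulDl h h' addrACA.
rewrite /tens_mul !(tens_liftE (tens_mul_balanced _)).
exact: (tens_liftD (tens_mul1_balanced _ _)).
Qed.
Fact tens_mulA : associative tens_mul.
Proof.
move=> x y z.
elim/tens_ind: x => [u v h h'|r s]; first by rewrite !tens_mulDl h h'.
elim/tens_homog_ind: y => [u v h h'|b c r' s' hr' hs'].
  by rewrite !(tens_mulDl, tens_mulDr) h h'.
elim/tens_homog_ind: z => [u v h h'|d e r1 s1 hr1 hs1].
  by rewrite !tens_mulDr h h'.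
rewrite (tens_mulE _ _ _ hr1) (tens_mulE _ _ _ hr').
by rewrite (tens_mulE _ _ _ (homogM hr' hr1)) (tens_mulE _ _ _ hr1) sginvM sginv_add !mulrA addbC.
Qed.
Fact tens_mul1l : left_id (tens 1 1) tens_mul.
Proof.
elim/tens_homog_ind => [u v h h'|b c r s hr hs]; first by rewrite tens_mulDr h h'.
by rewrite (tens_mulE _ _ _ hr) sginv1 !mul1r.
Qed.
Fact tens_mul1r : right_id (tens 1 1) tens_mul.
Proof.
elim/tens_ind => [u v h h'|r s]; first by rewrite tens_mulDl h h'.
by rewrite (tens_mulE _ _ _ (@homog1 R)) /= !mulr1.
Qed.
HB.instance Definition _ := GRing.Zmodule_isPzRing.Build Tens
  tens_mulA tens_mul1l tens_mul1r tens_mulDl tens_mulDr.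

Lemma tensM r s b r' s' : homog b r' ->
  tens r s * tens r' s' = tens (r * r') (sginv b s * s').
Proof. exact: tens_mulE. Qed.

Fact tens_homog1 : homog false (1 : Tens).
Proof. exact: (homog_tens (@homog1 R) (@homog1 S)). Qed.

Fact tens_homogM b c (x y : Tens) :
  homog b x -> homog c y -> homog (b (+) c) (x * y).
Proof.
have h0 d : homog d (0 : Tens) by exact: homog0.
have h (u v : Tens) : homog (b (+) c) (hproj b u * hproj c v).
  elim/tens_homog_ind: u => [u u' h h'|d e r s hr hs].
    by rewrite hprojD mulrDl; apply: homogD.
  elim/tens_homog_ind: v => [u u' h h'|d' e' r' s' hr' hs'].
    by rewrite hprojD mulrDr; apply: homogD.
  rewrite (homog_proj _ (homog_tens hr hs)) (homog_proj _ (homog_tens hr' hs')).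
  case: eqP => [->|_]; last by rewrite mul0r.
  case: eqP => [->|_]; last by rewrite mulr0.
  rewrite (tensM _ _ _ hr') addbACA.
  exact: homog_tens (homogM hr hr') (homogM (homog_sginv _ hs) hs').
by move=> hx hy; rewrite -(hx : hproj _ _ = _) -(hy : hproj _ _ = _).
Qed.
HB.instance Definition _ := isSuperRing.Build Tens tens_homog1 tens_homogM.

(* Koszul sign rule, g being the parity of G:
   (F (x) G)(r (x) s) = (-1)^{g|r|} F r (x) G s *)
Definition tens_op (g : bool) (F : R -> R) (G : S -> S) : Tens -> Tens :=
  tens_lift (fun r s => tens (F (sginv g r)) (G s)).

Section TensOp.
Variables (g : bool) (F : R -> R) (G : S -> S).
Hypotheses (FD : {morph F : r r' / r + r'}) (GD : {morph G : s s' / s + s'})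
  (FA : forall r a, F (r * inA a) = F r * inA a)
  (GA : forall a s, G (inA a * s) = inA (sginv g a) * G s).

Fact tens_op_balanced : balanced (fun r s => tens (F (sginv g r)) (G s)).
Proof.
split=> [r r' s|r s s'|r a s].
- by rewrite sginvD FD tensDl.
- by rewrite GD tensDr.
- by rewrite sginvM -inA_sginv FA tensA GA.
Qed.

Lemma tens_opE r s : tens_op g F G (tens r s) = tens (F (sginv g r)) (G s).
Proof. exact: (tens_liftE tens_op_balanced). Qed.

Lemma tens_opD x y : tens_op g F G (x + y) = tens_op g F G x + tens_op g F G y.
Proof. exact: (tens_liftD tens_op_balanced). Qed.
End TensOp.
End Tensor.

Arguments tens {A R S} r s.

(* Parity change: Pi M has the elements of M with opposite parity, and
   a (pi m) = (-1)^{|a|} pi (a m). *)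
Definition Pi (A : superRingType) (M : superModType A) : Type := M.
Definition toPi (A : superRingType) (M : superModType A) (m : M) : Pi M := m.

Section ParityChange.
Variables (A : superRingType) (M : superModType A).

HB.instance Definition _ := GRing.Zmodule.on (Pi M).

Definition Pi_scale (a : A) (m : Pi M) : Pi M := toPi (ginv a *: (m : M)).

Fact Pi_scalerA a b m : Pi_scale a (Pi_scale b m) = Pi_scale (a * b) m.
Proof. by rewrite /Pi_scale /toPi scalerA -(sginvM true). Qed.
Fact Pi_scale1 : left_id 1 Pi_scale.
Proof. by move=> m; rewrite /Pi_scale /toPi -[ginv 1]/(sginv true 1) sginv1 scale1r. Qed.
Fact Pi_scaleDr : right_distributive Pi_scale +%R.
Proof. by move=> a m n; apply: scalerDr. Qed.
Fact Pi_scaleDl m : {morph Pi_scale^~ m : a b / a + b}.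
Proof. by move=> a b; rewrite /Pi_scale /toPi ginvD scalerDl. Qed.
HB.instance Definition _ := GRing.Zmodule_isLmodule.Build A (Pi M)
  Pi_scalerA Pi_scale1 Pi_scaleDr Pi_scaleDl.

Definition Pi_proj (b : bool) (m : Pi M) : Pi M := toPi (hproj (~~ b) (m : M)).
Fact Pi_projD b x y : Pi_proj b (x + y) = Pi_proj b x + Pi_proj b y.
Proof. exact: hprojD. Qed.
Fact Pi_projK b c x : Pi_proj b (Pi_proj c x) = if b == c then Pi_proj c x else 0.
Proof. by rewrite /Pi_proj /toPi hprojK; case: b c => [] []. Qed.
Fact Pi_proj_sum x : Pi_proj false x + Pi_proj true x = x.
Proof. by rewrite addrC; apply: hproj_sum. Qed.
HB.instance Definition _ := isSuperZmodule.Build (Pi M) Pi_projD Pi_projK Pi_proj_sum.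

Fact Pi_homogZ b c (a : A) (m : Pi M) :
  homog b a -> homog c m -> homog (b (+) c) (a *: m).
Proof.
move=> ha hm; change (homog (~~ (b (+) c)) (sginv true a *: (m : M))).
by rewrite -addbN; apply: homogZ => //; apply: homog_sginv.
Qed.
HB.instance Definition _ := isSuperModule.Build A (Pi M) Pi_homogZ.
End ParityChange.

(* A^{p|q}: coordinates in a basis indexed by 'I_p + 'I_q, the first p basis
   vectors even and the last q odd. *)
Definition fsmod (A : superRingType) (p q : nat) : Type := {ffun 'I_p + 'I_q -> A^o}.

Definition bpar {p q : nat} (i : 'I_p + 'I_q) : bool := if i is inr _ then true else false.

Section FreeSuperModule.
Variables (A : superRingType) (p q : nat).
Local Notation V := (fsmod A p q).

HB.instance Definition _ := GRing.Lmodule.copy V {ffun 'I_p + 'I_q -> A^o}.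

Definition fs_proj (b : bool) (v : V) : V :=
  [ffun i => hproj (b (+) bpar i) (v i : A)].
Fact fs_projD b x y : fs_proj b (x + y) = fs_proj b x + fs_proj b y.
Proof. by apply/ffunP => i; rewrite !ffunE hprojD. Qed.
Fact fs_projK b c x : fs_proj b (fs_proj c x) = if b == c then fs_proj c x else 0.
Proof.
apply/ffunP => i; rewrite !ffunE hprojK.
have -> : (b (+) bpar i == c (+) bpar i) = (b == c) by case: b c (bpar i) => [] [] [].
by case: eqP; rewrite !ffunE.
Qed.
Fact fs_proj_sum x : fs_proj false x + fs_proj true x = x.
Proof.
apply/ffunP => i; rewrite !ffunE; case: (bpar i) => /=; last exact: hproj_sum.
by rewrite addrC; apply: hproj_sum.
Qed.
HB.instance Definition _ := isSuperZmodule.Build V fs_projD fs_projK fs_proj_sum.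

Fact fs_homogZ b c (a : A) (v : V) :
  homog b a -> homog c v -> homog (b (+) c) (a *: v).
Proof.
move=> ha /ffunP hv; apply/ffunP => i; rewrite !ffunE -addbA.
by apply: (homogM ha); rewrite /homog -[in RHS]hv !ffunE.
Qed.
HB.instance Definition _ := isSuperModule.Build A V fs_homogZ.

Definition fs_basis (i : 'I_p + 'I_q) : V := [ffun j => ((j == i)%:R : A)].

(* The left coordinates: w = sum_i c_i pi(e_i), where the parity involution comes
   from the action of A on Pi V. *)
Definition Pi_coord (i : 'I_p + 'I_q) (w : Pi V) : A := ginv ((w : V) i).

Lemma Pi_coordE (w : Pi V) : w = \sum_i Pi_coord i w *: toPi (fs_basis i : V).
Proof.
have E i : Pi_coord i w *: toPi (fs_basis i : V) = toPi ((w : V) i *: (fs_basis i : V)).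
  rewrite [LHS]/(toPi _) /Pi_coord; congr (toPi (_ *: _)).
  exact: (@sginv_add A true true).
rewrite (eq_bigr _ (fun i _ => E i)).
have -> : \sum_i toPi ((w : V) i *: (fs_basis i : V)) = toPi (\sum_i (w : V) i *: (fs_basis i : V)).
  by [].
rewrite /toPi; apply/ffunP => j; rewrite sum_ffunE (bigD1 j) //= big1.
  by rewrite !ffunE eqxx addr0 -[_ *: _]/(_ * _) mulr1.
by move=> i ij; rewrite !ffunE eq_sym (negbTE ij) -[_ *: _]/(_ * _) mulr0.
Qed.

End FreeSuperModule.

Arguments fs_basis {A p q} i.

Section Koszul.
Variables (A : superComRingType) (p q : nat).
Local Notation V := (fsmod A p q).

(* The partial derivative of Sym(Pi V) with respect to pi(e_i), of the same
   parity as pi(e_i); its value on w = sum_i c_i pi(e_i) is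
   (-1)^{|pi(e_i)||c_i|} c_i. *)
Definition partial (i : 'I_p + 'I_q) : Sym (Pi V) -> Sym (Pi V) :=
  symderiv (~~ bpar i) (fun w => sginv (~~ bpar i) (Pi_coord i w)).

Lemma partial_superfunctional (i : 'I_p + 'I_q) :
  superfunctional (~~ bpar i) (fun w : Pi V => sginv (~~ bpar i) (Pi_coord i w)).
Proof.
split=> [v w|a w|b w hw].
- by rewrite /Pi_coord [(_ + _ : V) i]ffunE ginvD sginvD.
- rewrite /Pi_coord -sginvM; congr sginv.
  rewrite [(_ *: _ : V) i]ffunE -[_ *: _]/(_ * _) -[LHS]/(sginv true _) sginvM.
  by rewrite (@sginv_add A true true).
- apply: homog_sginv; apply: (homog_sginv true).
  rewrite /homog -[in RHS](hw : hproj _ _ = _) [in RHS]ffunE.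
  by rewrite addbN -addNb.
Qed.

Lemma partial_inA i (a : A) : partial i (inA a) = 0.
Proof. exact: (symderiv_inA (partial_superfunctional i)). Qed.

Lemma partial_basis i j : partial i (gen (toPi (fs_basis j : V))) = (i == j)%:R.
Proof.
rewrite /partial (symderiv_gen (partial_superfunctional i)) /Pi_coord ffunE.
rewrite -[ginv _]/(sginv true ((i == j)%:R : A)).
by case: eqP => _; rewrite ?sginv1 ?inA1 // !sginv0 inA0.
Qed.

Lemma partialM i x y :
  partial i (x * y) = partial i x * y + sginv (~~ bpar i) x * partial i y.
Proof. exact: (symderivM (partial_superfunctional i)). Qed.

Definition koszul : Type := Tens (Sym V) (Sym (Pi V)).
HB.instance Definition _ := SuperRing.on koszul.

(* K_n for n : int; it is R (x) Sym^k(Pi V) for n = -k, and 0 for n > 0. *)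
Definition koszul_comp (n : int) : set koszul := fun m =>
  match n with
  | Posz (S _) => m = 0
  | _ => exists (N : nat) (r : 'I_N -> Sym V) (s : 'I_N -> Sym (Pi V)),
      (forall i, symk `|n|%N (s i)) /\ m = \sum_(i < N) tens (r i) (s i)
  end.

Definition koszul_inR (r : Sym V) : koszul := tens r 1.

Definition evar (i : 'I_p) : Sym V := gen (fs_basis (inl i) : V).
Definition ovar (j : 'I_q) : Sym V := gen (fs_basis (inr j) : V).
Definition d_chi (i : 'I_p) : Sym (Pi V) -> Sym (Pi V) := partial (inl i).
Definition d_ell (j : 'I_q) : Sym (Pi V) -> Sym (Pi V) := partial (inr j).

(* The first argument of tens_op is the parity of d_chi i, resp. d_ell j. *)
Definition koszul_diff (m : koszul) : koszul :=
  \sum_(i < p) tens_op true (fun r => evar i * r) (d_chi i) m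
  + \sum_(j < q) tens_op false (fun r => ovar j * r) (d_ell j) m.

Let partialD i : {morph partial i : x y / x + y}.
Proof. exact: (symderivD (partial_superfunctional i)). Qed.
Let partialZ i (a : A) s :
  partial i (inA a * s) = inA (sginv (~~ bpar i) a) * partial i s.
Proof. exact: (symderivZ (partial_superfunctional i)). Qed.
Let lmulD (y : Sym V) : {morph (fun r => y * r) : r r' / r + r'}.
Proof. by move=> r r'; rewrite mulrDr. Qed.
Let lmulA (y : Sym V) r (a : A) : y * (r * inA a) = y * r * inA a.
Proof. by rewrite mulrA. Qed.

Lemma koszul_diffD : {morph koszul_diff : m n / m + n}.
Proof.
move=> m n; rewrite /koszul_diff addrACA -!big_split; congr (_ + _).
- apply: eq_bigr => i _; apply: tens_opD;
    [exact: lmulD | exact: partialD | exact: lmulA | exact: (partialZ (inl i))].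
- apply: eq_bigr => j _; apply: tens_opD;
    [exact: lmulD | exact: partialD | exact: lmulA | exact: (partialZ (inr j))].
Qed.

Lemma koszul_diffE r s : koszul_diff (tens r s) =
  \sum_(i < p) tens (evar i * ginv r) (d_chi i s)
  + \sum_(j < q) tens (ovar j * r) (d_ell j s).
Proof.
congr (_ + _).
- apply: eq_bigr => i _; apply: tens_opE;
    [exact: lmulD | exact: partialD | exact: lmulA | exact: (partialZ (inl i))].
- apply: eq_bigr => j _; apply: tens_opE;
    [exact: lmulD | exact: partialD | exact: lmulA | exact: (partialZ (inr j))].
Qed.
End Koszul.

Arguments koszul_comp {A p q} n.
Arguments koszul_inR {A p q} r.
Arguments koszul_diff {A p q} m.

(* For a superring K graded by Kn, with R-algebra structure given by eta. *)
Record dg_algebra (R K : superRingType) (eta : R -> K) (Kn : int -> set K)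
    (d : K -> K) : Prop := {
  dg_additive : forall x y, d (x + y) = d x + d y;
  dg_odd : forall b x, homog b x -> homog (~~ b) (d x);
  dg_degree : forall n x, Kn n x -> Kn (n + 1) (d x);
  dg_linear : forall b r m, homog b r ->
    d (eta r * m) = (-1) ^+ b * (eta r * d m);
  dg_leibniz : forall b s t, homog b s ->
    d (s * t) = d s * t + (-1) ^+ b * (s * d t);
  dg_square : forall x, d (d x) = 0 }.

(* Main.v *)
(* Each summand of the differential is e_i D_i with D_i = 1 (x) d/d(pi e_i) a
   superderivation that is superlinear over R, and e_i supercentral of parity
   opposite to that of D_i; hence the sum delta is an odd superderivation which
   is R-superlinear. Its square is then additive, vanishes on R and is an even
   derivation, so it suffices to see that it kills 1 (x) w for w in Pi V, and
   delta (1 (x) w) lies in R (x) 1, where delta is zero. *)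
Require Import Defs.
From HB Require Import structures.
From mathcomp Require Import all_boot all_algebra.

Set Implicit Arguments.
Unset Strict Implicit.
Unset Printing Implicit Defensive.

Import GRing.Theory.
Local Open Scope ring_scope.

Lemma mulr_signb (R : pzRingType) b (x : R) :
  (-1) ^+ (b : bool) * x = if b then - x else x.
Proof. by case: b; rewrite ?expr1 ?expr0 ?mulN1r ?mul1r. Qed.

(** * Supercommutation with generators, and the symmetric powers inside [Sym M] *)

Section SymmetricAlgebra.
Variables (A : superComRingType) (M : superModType A).
Implicit Types (x y : Sym M) (m : M).

Lemma genN m : gen (- m) = - gen m.
Proof. by apply/eqP; rewrite -addr_eq0 -genD addNr gen0. Qed.

Lemma gen_sginv b m : gen (sginv b m) = sginv b (gen m).
Proof.
elim/homog_ind: m => [m n hm hn|c m hm]; first by rewrite !(sginvD, genD) hm hn.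
rewrite (sginv_homog _ hm) (sginv_homog _ (homog_gen hm)).
by case: ifP => // _; exact: genN.
Qed.

(** The presentation relates only generators and scalars. The rule extends to all of [Sym M] because
    [sginv b] is a ring endomorphism, so the set of [x] obeying it is closed under products. *)
Lemma mulr_gen b m x : homog b m -> x * gen m = gen m * sginv b x.
Proof.
move=> hm; elim/sym_ind: x => [a|n|x y hx hy|x hx|x y hx hy].
- elim/homog_ind: a => [a a' h h'|c a ha].
    by rewrite sym_inAD mulrDl h h' -mulrDr -sginvD.
  rewrite (sginv_homog _ (sym_homog_inA M ha)).
  have := sym_gen_inA ha hm; rewrite mulr_signb andbC.
  by case: (b && c) => [/(congr1 -%R)|] h; rewrite ?mulrN h ?opprK.
- elim/homog_ind: n => [a a' h h'|c n hn].
    by rewrite genD mulrDl h h' -mulrDr -sginvD.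
  rewrite (gen_supermulC hn hm) (sginv_homog _ (homog_gen hn)) mulr_signb andbC.
  by case: ifP; rewrite ?mulrN.
- by rewrite mulrDl hx hy sginvD mulrDr.
- by rewrite mulNr hx sginvN mulrN.
- by rewrite -mulrA hy mulrA hx -mulrA -sginvM.
Qed.

Lemma symk0 k : symk k (0 : Sym M).
Proof. by exists 0%N, (fun=> 0), (fun _ _ => 0); rewrite big_ord0. Qed.

Lemma symkD k x y : symk k x -> symk k y -> symk k (x + y).
Proof.
move=> [n [a [m ->]]] [n' [a' [m' ->]]].
exists (n + n')%N, (fun i => match split i with inl j => a j | inr j => a' j end),
  (fun i => match split i with inl j => m j | inr j => m' j end).
rewrite big_split_ord; congr (_ + _); apply: eq_bigr => i _.
  by rewrite (unsplitK (inl _ i)).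
by rewrite (unsplitK (inr _ i)).
Qed.

Lemma symk_sum k n (F : 'I_n -> Sym M) :
  (forall i, symk k (F i)) -> symk k (\sum_i F i).
Proof. by move=> h; apply: big_ind => //; [exact: symk0 | exact: symkD]. Qed.

Lemma symk_prod k (a : A) (m : 'I_k -> M) :
  symk k (inA a * \prod_(j < k) gen (m j)).
Proof. by exists 1%N, (fun=> a), (fun=> m); rewrite big_ord1. Qed.

Lemma symk_inA k (a : A) x : symk k x -> symk k (inA a * x).
Proof.
move=> [n [c [m ->]]]; rewrite mulr_sumr; apply: symk_sum => i.
by rewrite mulrA -inAM; exact: symk_prod.
Qed.

(** A coefficient [a] of parity [b] must return to the front of the product; passing [gen m] it
    twists [m] into [sginv b m], which is again an element of [M]. *)
Lemma symk_gen k m x : symk k x -> symk k.+1 (gen m * x).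
Proof.
move=> [n [c [u ->]]]; rewrite mulr_sumr; apply: symk_sum => i.
elim/homog_ind: (c i) => [a a' h h'|b a ha].
  by rewrite inAD mulrDl mulrDr; exact: symkD.
rewrite mulrA (sym_comm_inA _ ha) -gen_sginv -mulrA.
(* The longer family puts the twisted [m] at index 0 and shifts the old factors up by one. *)
have := symk_prod a (fun j : 'I_k.+1 =>
  if unlift ord0 j is Some j' then u i j' else sginv b m).
rewrite big_ord_recl unlift_none.
by under eq_bigr do rewrite liftK.
Qed.

(** * Superderivations of the symmetric algebra: parity and degree *)

Section Derivation.
Variables (g : bool) (phi : M -> A).
Hypothesis phiP : superfunctional g phi.
Local Notation D := (symderiv g phi).

Lemma symderiv0 : D 0 = 0.
Proof. by rewrite -sym_inA0; exact: symderiv_inA. Qed.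

Lemma symderivN x : D (- x) = - D x.
Proof. by apply/eqP; rewrite -addr_eq0 -(symderivD phiP) addNr symderiv0. Qed.

(** Parity is expressed through projections because induction on [Sym M] passes through sums and
    products of inhomogeneous elements. *)
Lemma hproj_symderiv b x : hproj b (D x) = D (hproj (b (+) g) x).
Proof.
have hM c (y z : Sym M) : hproj c (y * z) =
    hproj false y * hproj c z + hproj true y * hproj (~~ c) z.
  exact: sym_projM.
elim/sym_ind: x b => [a|m|x y hx hy|x hx|x y hx hy] b.
- by rewrite [hproj _ (sym_inA a)]sym_proj_inA !(symderiv_inA phiP) hproj0.
- rewrite [hproj _ (gen m)]sym_proj_gen !(symderiv_gen phiP) [LHS]sym_proj_inA.
  congr sym_inA; have [phiD _ phih] := phiP.
  elim/homog_ind: m => [m n hm hn|c m hm]; first by rewrite phiD !hprojD phiD hm hn.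
  rewrite (homog_proj _ hm) (homog_proj _ (phih _ _ hm)).
  have phi0 : phi 0 = 0 by apply: (addrI (phi 0)); rewrite -phiD !addr0.
  by case: b c (g) {hm} => [] [] [] //=; rewrite phi0.
- by rewrite !(symderivD phiP, hprojD) hx hy.
- by rewrite !(symderivN, hprojN) hx.
- rewrite (symderivM phiP) hprojD !hM (symderivD phiP) !(symderivM phiP).
  rewrite !hproj_sginv !hx !hy.
  (* For odd [g] the even and odd parts of the first factor trade places, whence the swap of
     summands. *)
  by rewrite [RHS]addrACA; case: b (g) => [] [] /=; rewrite // [X in X + _ = _]addrC.
Qed.

Lemma homog_symderiv b x : homog b x -> homog (b (+) g) (D x).
Proof. by move=> hx; rewrite /homog hproj_symderiv addbK hx. Qed.

(** Induction by the Leibniz rule on the first factor. For [k = 0] the truncated [k.-1] is harmless: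
    the derivative of the empty product is 0. *)
Lemma symderiv_prod k (m : 'I_k -> M) : symk k.-1 (D (\prod_(j < k) gen (m j))).
Proof.
elim: k m => [|k IH] m.
  by rewrite big_ord0 -sym_inA1 (symderiv_inA phiP); exact: symk0.
rewrite big_ord_recl (symderivM phiP) (symderiv_gen phiP) -gen_sginv /=.
apply: symkD; first exact: symk_prod.
case: k IH m => [|k] IH m; last by apply: symk_gen; exact: IH.
by rewrite big_ord0 -sym_inA1 (symderiv_inA phiP) mulr0; exact: symk0.
Qed.

Lemma symk_symderiv k x : symk k x -> symk k.-1 (D x).
Proof.
move=> [n [a [m ->]]].
rewrite (big_morph _ (symderivD phiP) symderiv0); apply: symk_sum => i.
by rewrite (symderivZ phiP); apply: symk_inA; exact: symderiv_prod.
Qed.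

(** [symk 0] is the image of [A]. The truncated predecessor hides this vanishing, which is what
    sends degree 0 of the complex to 0. *)
Lemma symderiv_symk0 x : symk 0 x -> D x = 0.
Proof.
move=> [n [a [m ->]]].
rewrite (big_morph _ (symderivD phiP) symderiv0) big1 // => i _.
by rewrite big_ord0 mulr1; exact: symderiv_inA.
Qed.

End Derivation.
End SymmetricAlgebra.

(** * The summands of the Koszul differential *)

Section Koszul.
Variables (A : superComRingType) (p q : nat).
Local Notation V := (fsmod A p q).
Local Notation K := (koszul A p q).
Local Notation delta := (@koszul_diff A p q).
Implicit Types (i : 'I_p + 'I_q) (x y : K).

Definition basis_var i : Sym V := gen (fs_basis i : V).

(** Here [~~ bpar i] is the parity of [partial i]: odd for the chi variables, even for the ell
    variables. Both sums of [koszul_diff] thus become one sum over the basis. *)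
Definition koszul_term i : K -> K :=
  tens_op (~~ bpar i) (fun r => basis_var i * r) (partial i).

Lemma koszul_diff_sum x : delta x = \sum_i koszul_term i x.
Proof. by rewrite big_sumType. Qed.

Let partialD i : {morph @partial A p q i : s t / s + t}.
Proof. exact: (symderivD (partial_superfunctional A i)). Qed.

Lemma koszul_termD i : {morph koszul_term i : x y / x + y}.
Proof.
move=> x y; apply: tens_opD => [r r'|s s'|r a|a s].
- exact: mulrDr.
- exact: partialD.
- exact: mulrA.
- exact: (symderivZ (partial_superfunctional A i)).
Qed.

Lemma koszul_termE i r s : koszul_term i (tens r s) =
  tens (basis_var i * sginv (~~ bpar i) r) (partial i s).
Proof.
apply: tens_opE => [r1 r'|s1 s'|r1 a|a s1].
- exact: mulrDr.
- exact: partialD.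
- exact: mulrA.
- exact: (symderivZ (partial_superfunctional A i)).
Qed.

Lemma homog_fs_basis i : homog (bpar i) (fs_basis i : V).
Proof.
apply/ffunP => j; rewrite !ffunE; case: eqP => [->|_]; last exact: hproj0.
by rewrite addbb; exact: homog1.
Qed.

Lemma homog_basis_var i : homog (bpar i) (basis_var i).
Proof. exact: homog_gen (homog_fs_basis i). Qed.

Lemma homog_partial i b s : homog b s -> homog (b (+) ~~ bpar i) (@partial A p q i s).
Proof. exact: (homog_symderiv (partial_superfunctional A i)). Qed.

Lemma partialN i s : @partial A p q i (- s) = - partial i s.
Proof. exact: (symderivN (partial_superfunctional A i)). Qed.

(** The parities of [basis_var i] and [partial i] add up to 1, so moving both past [x] gives the
    sign of an odd operator, that is [ginv x]. *)
Lemma koszul_termM i x y :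
  koszul_term i (x * y) = koszul_term i x * y + ginv x * koszul_term i y.
Proof.
elim/tens_homog_ind: x => [x x' h h'|b c r s hr hs].
  by rewrite mulrDl !koszul_termD h h' ginvD !mulrDl addrACA.
elim/tens_homog_ind: y => [y y' h h'|b' c' r' s' hr' hs'].
  by rewrite mulrDr !koszul_termD h h' !mulrDr addrACA.
rewrite (tensM _ _ _ hr') !koszul_termE (tensM _ _ _ hr').
rewrite (_ : ginv _ = sginv true (tens r s)) // (sginv_homog _ (homog_tens hr hs)).
rewrite partialM tensDr sginvM sginv_add.
rewrite !(sginv_homog _ hs) !(sginv_homog _ hr) !(sginv_homog _ hr').
rewrite !(sginv_homog _ (homog_partial i hs)).
have hr2 : homog (bpar i (+) b') (basis_var i * r').
  exact: homogM (homog_basis_var i) hr'.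
have E : r * basis_var i = (if bpar i && b then - (basis_var i * r) else basis_var i * r).
  rewrite (mulr_gen _ (homog_fs_basis i)) (sginv_homog _ hr).
  by case: ifP; rewrite ?mulrN.
have hg : ginv s = if c then - s else s := sginv_homog true hs.
(* What remains is a sign check over the parities of [basis_var i], [r], [r'] and [s]. *)
case: (bpar i) b b' c hr hr' hs hr2 E hg =>
  [] [] [] [] hr hr' hs hr2 E hg /=;
  rewrite ?(mulNr, mulrN, opprK, partialN, tensNl, tensNr) /=.
all: rewrite (tensM _ _ _ hr2) [r * (_ * _)]mulrA E /= ?hg.
all: by rewrite ?(mulNr, mulrN, opprK, tensNl, tensNr) ?mulrA.
Qed.

(** * Leibniz rule, parity and square of the differential *)

Lemma koszul_diff0 : delta 0 = 0.
Proof. by apply: (addrI (delta 0)); rewrite -koszul_diffD !addr0. Qed.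

Lemma koszul_diffN x : delta (- x) = - delta x.
Proof. by apply/eqP; rewrite -addr_eq0 -koszul_diffD addNr koszul_diff0. Qed.

Lemma koszul_diffM x y : delta (x * y) = delta x * y + ginv x * delta y.
Proof.
rewrite !koszul_diff_sum mulr_suml mulr_sumr -big_split.
by apply: eq_bigr => i _; exact: koszul_termM.
Qed.

Lemma homog_koszul_diff b x : homog b x -> homog (~~ b) (delta x).
Proof.
(* Projecting an arbitrary [u] allows induction on sums of pure tensors, whose terms need not share
   the parity of [x]. *)
suff h u : homog (~~ b) (delta (hproj b u)) by move=> hx; rewrite -(hx : hproj _ _ = _).
elim/tens_homog_ind: u => [u u' h h'|c d r s hr hs].
  by rewrite hprojD koszul_diffD; exact: homogD.
rewrite (homog_proj _ (homog_tens hr hs)).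
case: eqP => [->|_]; last by rewrite koszul_diff0; exact: homog0.
rewrite koszul_diff_sum; apply: big_ind => [|y z|i _].
- exact: homog0.
- exact: homogD.
rewrite koszul_termE.
have -> : ~~ (c (+) d) = (bpar i (+) c) (+) (d (+) ~~ bpar i).
  by case: (bpar i) c d {hr hs} => [] [] [].
apply: homog_tens; last exact: homog_partial.
exact: homogM (homog_basis_var i) (homog_sginv _ hr).
Qed.

Lemma koszul_diff_inR r : delta (koszul_inR r) = 0.
Proof.
rewrite koszul_diff_sum big1 // => i _.
by rewrite koszul_termE -inA1 partial_inA tens0r.
Qed.

Lemma koszul_diff_ginv x : delta (ginv x) = - ginv (delta x).
Proof.
elim/homog_ind: x => [x y hx hy|b x hx].
  rewrite [ginv (x + y)]ginvD [LHS]koszul_diffD hx hy koszul_diffD (ginvD (delta x)).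
  exact: esym (opprD _ _).
have := sginv_homog true hx; have := sginv_homog true (homog_koszul_diff hx).
rewrite /= => -> ->.
by case: b {hx}; rewrite /= ?koszul_diffN ?opprK.
Qed.

(** In the expansion the cross terms are [ginv (delta x) * delta y] and [delta (ginv x) * delta y];
    they cancel because an odd operator anticommutes with [ginv]. *)
Lemma koszul_diff_sqM x y :
  delta (delta x) = 0 -> delta (delta y) = 0 -> delta (delta (x * y)) = 0.
Proof.
move=> hx hy; rewrite (koszul_diffM x) koszul_diffD.
rewrite (koszul_diffM (delta x)) (koszul_diffM (ginv x)) hx hy.
by rewrite mul0r mulr0 add0r addr0 koszul_diff_ginv mulNr subrr.
Qed.

Lemma koszul_diff_sq x : delta (delta x) = 0.
Proof.
elim/tens_ind: x => [x y hx hy|r s]; first by rewrite (koszul_diffD x) koszul_diffD hx hy addr0.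
(* Since [delta] kills the factor from [R], only tensors [1 (x) s] remain, handled by induction on
   [s]. *)
have -> : tens r s = koszul_inR r * (tens 1 s : K).
  by rewrite (tensM _ _ _ (homog1 : homog false (1 : Sym V))) mulr1 mul1r.
apply: koszul_diff_sqM; first by rewrite koszul_diff_inR koszul_diff0.
elim/sym_ind: s => [a|w|s s' h h'|s h|s s' h h'].
(* A scalar crosses the tensor sign, so this element comes from [R]. *)
- by rewrite -[sym_inA a]mulr1 -tensA koszul_diff_inR koszul_diff0.
(* Each partial derivative of a generator is a scalar, which moves to the left factor. *)
- have -> : delta (tens 1 (gen w)) = \sum_i
      koszul_inR (basis_var i * inA (sginv (~~ bpar i) (Pi_coord i w))).
    rewrite koszul_diff_sum; apply: eq_bigr => i _.
    rewrite koszul_termE sginv1 /partial.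
    rewrite (symderiv_gen (partial_superfunctional A i)) mulr1.
    by rewrite -[X in tens _ X]mulr1 -tensA.
  rewrite (big_morph _ (@koszul_diffD A p q) koszul_diff0) big1 // => i _.
  exact: koszul_diff_inR.
- by rewrite tensDr (koszul_diffD (tens _ _)) koszul_diffD h h' addr0.
- by rewrite tensNr (koszul_diffN (tens _ _)) koszul_diffN h oppr0.
- have -> : tens 1 (s * s') = (tens 1 s : K) * tens 1 s'.
    by rewrite (tensM _ _ _ (homog1 : homog false (1 : Sym V))) mulr1.
  exact: koszul_diff_sqM.
Qed.

(** * The homological grading *)

Section Degree.
Variable k : nat.
Local Notation Kk := (@koszul_comp A p q (- k%:Z)).

(** Degree 0 and the negative degrees fall under different constructors of [int]; this gives them
    one description. *)
Lemma koszul_compP x : Kk x <->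
  exists (N : nat) (r : 'I_N -> Sym V) (s : 'I_N -> Sym (Pi V)),
    (forall l, symk k (s l)) /\ x = \sum_(l < N) tens (r l) (s l).
Proof. by case: k => [|k']; rewrite ?oppr0 // -NegzE. Qed.

Lemma koszul_comp0 : Kk 0.
Proof.
apply/koszul_compP; exists 0%N, (fun=> 0), (fun=> 0).
by rewrite big_ord0; split=> // - [].
Qed.

Lemma koszul_compD x y : Kk x -> Kk y -> Kk (x + y).
Proof.
move=> /koszul_compP[N [r [s [hs ->]]]] /koszul_compP[N' [r' [s' [hs' ->]]]].
apply/koszul_compP.
exists (N + N')%N, (fun l => match split l with inl j => r j | inr j => r' j end),
  (fun l => match split l with inl j => s j | inr j => s' j end).
split=> [i|]; first by case: (split i).
rewrite big_split_ord; congr (_ + _); apply: eq_bigr => i _.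
  by rewrite (unsplitK (inl _ i)).
by rewrite (unsplitK (inr _ i)).
Qed.

Lemma koszul_comp_tens r s : symk k s -> Kk (tens r s).
Proof.
by move=> hs; apply/koszul_compP; exists 1%N, (fun=> r), (fun=> s); rewrite big_ord1.
Qed.
End Degree.

Lemma koszul_comp_diff n x : koszul_comp n x -> koszul_comp (n + 1) (delta x).
Proof.
case: n => [[|n]|n].
(* From degree 0 the target is degree 1, which is zero, so the image must vanish outright. *)
- move/(koszul_compP 0) => [N [r [s [hs ->]]]]; rewrite add0r /=.
  rewrite (big_morph _ (@koszul_diffD A p q) koszul_diff0) big1 // => i _.
  rewrite koszul_diff_sum big1 // => j _.
  by rewrite koszul_termE [partial j _](symderiv_symk0 (partial_superfunctional A j) (hs i)) tens0r.
- by move=> hx; rewrite -PoszD addn1 /= (hx : x = 0) koszul_diff0.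
rewrite NegzE => /koszul_compP[N [r [s [hs ->]]]].
(* The source degree is [-(n+1)], so the predecessor taken by the derivative is exact here. *)
have -> : - n.+1%:Z + 1 = - n%:Z :> int by rewrite -addn1 PoszD opprD addrNK.
rewrite (big_morph _ (@koszul_diffD A p q) koszul_diff0).
apply: big_ind => [||i _]; [exact: koszul_comp0|exact: koszul_compD|].
rewrite koszul_diff_sum.
apply: big_ind => [||j _]; [exact: koszul_comp0|exact: koszul_compD|].
rewrite koszul_termE; apply: koszul_comp_tens.
exact: (symk_symderiv (partial_superfunctional A j) (hs i)).
Qed.

End Koszul.

Theorem theorem3p1 (k : fieldType) (k_char0 : [pchar k] =i pred0)
    (A : superComAlgType k) (p q : nat) :
  dg_algebra (@koszul_inR A p q) (@koszul_comp A p q) (@koszul_diff A p q).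
Proof.
have leibniz b (s t : koszul A p q) : homog b s ->
    koszul_diff (s * t) = koszul_diff s * t + (-1) ^+ b * (s * koszul_diff t).
  move=> hs; rewrite koszul_diffM (sginv_homog true hs : ginv s = _) mulr_signb.
  by case: b {hs}; rewrite /= ?mulNr.
split=> //.
- exact: koszul_diffD.
- exact: homog_koszul_diff.
- exact: koszul_comp_diff.
(* Superlinearity over [R] is the Leibniz rule with first factor [koszul_inR r], which [koszul_diff]
   kills. *)
- move=> b r m hr.
  have hR : homog b (koszul_inR r).
    by rewrite -[b]addbF; apply: homog_tens => //; exact: homog1.
  by rewrite (leibniz _ _ _ hR) koszul_diff_inR mul0r add0r.
- exact: koszul_diff_sq.
Qed.
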